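(* Let $AB_1B_2D_2D_1$ be a 4-right pentagon in the hyperbolic plane with right angles at $B_1, B_2, D_1, D_2$. Let $A_*$ be the orthogonal projection of $A$ onto the line $B_2D_2$, and let $C_*$ be the intersection with $B_2D_2$ of the common perpendicular to the lines $B_1D_1$ and $B_2D_2$. Then the midpoint of $\overline{B_2D_2}$ is also the midpoint of $\overline{A_*C_*}$.
   Context: A 4-right pentagon is a hyperbolic pentagon (a simple polygon whose vertices are listed in cyclic order) having at least four right angles, here at all the vertices different from $A$ (the angle at $A$ may or may not be right). The midpoint of a degenerate segment (equal endpoints) is that endpoint. *)

(* Defs.v *)
(* MathComp / MathComp-Analysis.  The hyperbolic plane is the hyperboloid model
   over an arbitrary [R : realType]. *)
From HB Require Import structures.
From mathcomp Require Import all_boot all_order all_algebra.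
From mathcomp Require Import all_classical all_reals all_analysis.

Set Implicit Arguments.
Unset Strict Implicit.
Unset Printing Implicit Defensive.

Import Order.TTheory GRing.Theory Num.Theory.

Local Open Scope classical_set_scope.
Local Open Scope ring_scope.

Definition lorentz (R : realType) (u v : 'rV[R]_3) : R :=
  u 0 1 * v 0 1 + u 0 2 * v 0 2 - u 0 0 * v 0 0.

Record hpoint (R : realType) := HPoint {
  hvec :> 'rV[R]_3 ;
  hvecP : (lorentz hvec hvec == -1) && (0 < hvec 0 0) }.

HB.instance Definition _ (R : realType) := [isSub for @hvec R].
HB.instance Definition _ (R : realType) := [Choice of hpoint R by <:].

Definition arcosh (R : realType) (x : R) : R := ln (x + Num.sqrt (x ^+ 2 - 1)).

Definition hdist (R : realType) (X Y : hpoint R) : R := arcosh (- lorentz X Y).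

(* [lorentz] is positive definite on the tangent space at [P] (the orthogonal
   complement of [P]), so it provides the Riemannian metric there.
   [hdir P X] is the projection of [X] to this tangent space: when [X <> P], it is
   a nonzero initial direction of the geodesic from [P] to [X]. *)
Definition hdir (R : realType) (P X : hpoint R) : 'rV[R]_3 :=
  hvec X + lorentz P X *: hvec P.

Definition tnorm (R : realType) (u : 'rV[R]_3) : R := Num.sqrt (lorentz u u).

(* The angle XPY, in [0, pi]; meaningful only when [X] and [Y] differ from [P]. *)
Definition hangle (R : realType) (X P Y : hpoint R) : R :=
  acos (lorentz (hdir P X) (hdir P Y) / (tnorm (hdir P X) * tnorm (hdir P Y))).

(* Geodesics are the intersections of the hyperboloid with linear planes. *)
Definition hline (R : realType) (X Y : hpoint R) : set (hpoint R) :=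
  [set Z | exists s t : R, hvec Z = s *: hvec X + t *: hvec Y].

Definition is_hline (R : realType) (L : set (hpoint R)) : Prop :=
  exists X Y : hpoint R, X <> Y /\ L = hline X Y.

Definition hsegment (R : realType) (X Y : hpoint R) : set (hpoint R) :=
  [set Z | exists s t : R,
     [/\ 0 <= s, 0 <= t & hvec Z = s *: hvec X + t *: hvec Y]].

Definition is_midpoint (R : realType) (X Y M : hpoint R) : Prop :=
  hsegment X Y M /\ hdist X M = hdist M Y.

Definition perpendicular (R : realType) (L M : set (hpoint R)) : Prop :=
  [/\ is_hline L, is_hline M &
    exists P X Y : hpoint R,
      [/\ L P /\ M P, L X /\ X <> P, M Y /\ Y <> P & hangle X P Y = pi / 2]].

Definition common_perpendicular (R : realType) (L M N : set (hpoint R)) : Prop :=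
  perpendicular N L /\ perpendicular N M.

Definition is_orth_projection (R : realType) (L : set (hpoint R))
    (A F : hpoint R) : Prop :=
  L F /\ exists N, [/\ perpendicular N L, N A & N F].

Definition polygon_side (R : realType) (n : nat) (p : n.-tuple (hpoint R))
    (i : 'I_n) : set (hpoint R) :=
  hsegment (tnth p i) (tnth p (ordS i)).

(* The vertices are distinct, and two sides meet only at a common vertex of
   cyclically consecutive sides. *)
Definition simple_polygon (R : realType) (n : nat) (p : n.-tuple (hpoint R)) :
    Prop :=
  injective (tnth p) /\
  forall (i j : 'I_n) (X : hpoint R), i <> j ->
    polygon_side p i X -> polygon_side p j X ->
    (j = ordS i /\ X = tnth p j) \/ (i = ordS j /\ X = tnth p i).

(* Cyclic order A, B1, B2, D2, D1.  The angles here are those between sides, in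
   [0, pi]; they are the interior angles, because one interior angle 3pi/2 and three
   interior angles in {pi/2, 3pi/2} already add up to at least 3pi, the strict upper
   bound for the angle sum of a hyperbolic pentagon. *)
Definition four_right_pentagon (R : realType) (A B1 B2 D2 D1 : hpoint R) : Prop :=
  simple_polygon [tuple A; B1; B2; D2; D1] /\
  [/\ hangle A B1 B2 = pi / 2, hangle B1 B2 D2 = pi / 2,
      hangle B2 D2 D1 = pi / 2 & hangle D2 D1 A = pi / 2].

(* Main.v *)
(* Put p = B2, q = D2 and let n be a normal vector of the line pq. The right angles
   at p and q give B1 = x p + b n and D1 = y q + d n, and those at B1 and D1 give
   -b <A, p> = x a and -d <A, q> = y a, where a is the n-coordinate of A. Write
   v = alpha p + beta q for the orthogonal projection of A to the plane of p and q;
   it is timelike because A is. Exchanging the coordinates of v gives the vector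
   v' = beta p + alpha q, of the same norm, with <v', p> = <A, q> and
   <v', q> = <A, p>. By the two relations, the line through v' perpendicular
   to pq is also perpendicular to B1 D1. Hence As = k v and Cs = k v' for one scalar
   k, so As + Cs is proportional to p + q: the two midpoints coincide. *)
Require Import Defs.
From mathcomp Require Import all_boot all_order all_algebra.
From mathcomp Require Import all_classical all_reals all_analysis.
From mathcomp Require Import ring lra.

Set Implicit Arguments.
Unset Strict Implicit.
Unset Printing Implicit Defensive.

Import Order.TTheory GRing.Theory Num.Theory.
Local Open Scope classical_set_scope.
Local Open Scope ring_scope.

(** * The Lorentz form and its cross product *)

Section Lorentz.
Variable R : realType.
Implicit Types u v w z n m : 'rV[R]_3.

Lemma rV3P u v : u 0 0 = v 0 0 -> u 0 1 = v 0 1 -> u 0 2 = v 0 2 -> u = v.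
Proof.
move=> h0 h1 h2; apply/rowP => -[[|[|[|//]]] Hi].
- by have -> : Ordinal Hi = 0 by apply: val_inj.
- by have -> : Ordinal Hi = 1 by apply: val_inj.
- by have -> : Ordinal Hi = 2 by apply: val_inj.
Qed.

Lemma lorentzC u v : lorentz u v = lorentz v u.
Proof. by rewrite /lorentz; ring. Qed.

Lemma lorentzDl u v w : lorentz (u + v) w = lorentz u w + lorentz v w.
Proof. by rewrite /lorentz !mxE; ring. Qed.

Lemma lorentzZl a u w : lorentz (a *: u) w = a * lorentz u w.
Proof. by rewrite /lorentz !mxE; ring. Qed.

Lemma lorentzDr u v w : lorentz w (u + v) = lorentz w u + lorentz w v.
Proof. by rewrite /lorentz !mxE; ring. Qed.

Lemma lorentzZr a u w : lorentz w (a *: u) = a * lorentz w u.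
Proof. by rewrite /lorentz !mxE; ring. Qed.

Definition lorentzE := (lorentzDl, lorentzDr, lorentzZl, lorentzZr).

(** The Euclidean cross product with its time coordinate negated, so that [lorentz (lcross u v) w]
    is the determinant of [u], [v], [w]. *)
Definition lcross u v : 'rV[R]_3 :=
  \row_(i < 3) [:: u 0 2 * v 0 1 - u 0 1 * v 0 2;
                   u 0 2 * v 0 0 - u 0 0 * v 0 2;
                   u 0 0 * v 0 1 - u 0 1 * v 0 0]`_i.

Lemma lcross_l u v : lorentz (lcross u v) u = 0.
Proof. by rewrite /lorentz !mxE /=; ring. Qed.

Lemma lcross_r u v : lorentz (lcross u v) v = 0.
Proof. by rewrite /lorentz !mxE /=; ring. Qed.

Lemma lcrossC u v : lcross u v = - lcross v u.
Proof. by apply: rV3P; rewrite !mxE /=; ring. Qed.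

(** The Binet-Cauchy identity; the signature reverses its usual sign. *)
Lemma lorentz_lcross u v w z :
  lorentz (lcross u v) (lcross w z) =
  lorentz u z * lorentz v w - lorentz u w * lorentz v z.
Proof. by rewrite /lorentz !mxE /=; ring. Qed.

Lemma lcrossA u v w :
  lcross (lcross u v) w = lorentz v w *: u - lorentz u w *: v.
Proof. by apply: rV3P; rewrite /lorentz !mxE /=; ring. Qed.

Lemma lcross0v v : lcross 0 v = 0.
Proof. by apply: rV3P; rewrite !mxE /=; ring. Qed.

(* Expansion in the frame [u], [v], [lcross u v]. *)
Lemma lcross_expand u v z :
  lorentz (lcross u v) (lcross u v) *: z = lorentz (lcross u v) z *: lcross u v
    + (lorentz u v * lorentz z v - lorentz v v * lorentz z u) *: u
    + (lorentz u v * lorentz z u - lorentz u u * lorentz z v) *: v.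
Proof. by apply: rV3P; rewrite /lorentz !mxE /=; ring. Qed.

Lemma lcross0_colinear u v : lorentz u u != 0 -> lcross u v = 0 ->
  v = (lorentz u v / lorentz u u) *: u.
Proof.
move=> uu uv0; have := lcrossA u v u; rewrite uv0 lcross0v => /esym/eqP.
rewrite subr_eq0 => /eqP h.
by rewrite mulrC -scalerA lorentzC h scalerA mulVf// scale1r.
Qed.

Lemma lcross_orth u v n : lorentz u n = 0 -> lorentz v n = 0 ->
  lcross (lcross u v) n = 0.
Proof. by move=> un vn; rewrite lcrossA un vn !scale0r subrr. Qed.

End Lorentz.

(** * Points of the hyperboloid and timelike vectors *)

Section Points.
Variable R : realType.
Implicit Types (u v w n m : 'rV[R]_3) (P X Y Z A : hpoint R).

Lemma hpoint_norm X : lorentz X X = -1.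
Proof. by case: X => v /= /andP[/eqP]. Qed.

Lemma hpoint_gt0 X : 0 < hvec X 0 0.
Proof. by case: X => v /= /andP[]. Qed.

(** Reversed Cauchy-Schwarz: on the hyperboloid, [(x 0 0 * y 0 0) ^+ 2 - (1 + t) ^+ 2] is a sum of
    three squares. *)
Lemma lorentz_le X Y : lorentz X Y <= -1.
Proof.
move: (hpoint_norm X) (hpoint_norm Y) (hpoint_gt0 X) (hpoint_gt0 Y).
rewrite /lorentz; move: (hvec X) (hvec Y) => x y hx hy x0 y0.
set t := x 0 1 * y 0 1 + x 0 2 * y 0 2.
suff : 1 + t <= x 0 0 * y 0 0 by lra.
rewrite leNgt; apply/negP => lt.
have xy0 : 0 < x 0 0 * y 0 0 by rewrite mulr_gt0.
have : (x 0 0 * y 0 0) ^+ 2 < (1 + t) ^+ 2 by rewrite ltr_pXn2r// ?nnegrE; lra.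
have -> : (x 0 0 * y 0 0) ^+ 2 = (1 + t) ^+ 2 + (x 0 1 - y 0 1) ^+ 2
   + (x 0 2 - y 0 2) ^+ 2 + (x 0 1 * y 0 2 - x 0 2 * y 0 1) ^+ 2.
  rewrite exprMn.
  have -> : x 0 0 ^+ 2 = 1 + x 0 1 ^+ 2 + x 0 2 ^+ 2 by lra.
  have -> : y 0 0 ^+ 2 = 1 + y 0 1 ^+ 2 + y 0 2 ^+ 2 by lra.
  by rewrite /t; ring.
have := sqr_ge0 (x 0 1 - y 0 1); have := sqr_ge0 (x 0 2 - y 0 2).
have := sqr_ge0 (x 0 1 * y 0 2 - x 0 2 * y 0 1); lra.
Qed.

Lemma hvec_inj : injective (@hvec R).
Proof. exact: val_inj. Qed.

(** Equality case of [lorentz_le]: the three squares vanish, and positivity settles the time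
    coordinate. *)
Lemma lorentz_eq X Y : lorentz X Y = -1 -> X = Y.
Proof.
move=> h; apply: hvec_inj; move: h.
move: (hpoint_norm X) (hpoint_norm Y) (hpoint_gt0 X) (hpoint_gt0 Y).
rewrite /lorentz; move: (hvec X) (hvec Y) => x y hx hy x0 y0 h.
have e : (x 0 0 * y 0 0) ^+ 2 = (1 + x 0 1 * y 0 1 + x 0 2 * y 0 2) ^+ 2.
  by congr (_ ^+ 2); lra.
have : (x 0 1 - y 0 1) ^+ 2
   + (x 0 2 - y 0 2) ^+ 2 + (x 0 1 * y 0 2 - x 0 2 * y 0 1) ^+ 2 = 0.
  move: e; rewrite exprMn.
  have -> : x 0 0 ^+ 2 = 1 + x 0 1 ^+ 2 + x 0 2 ^+ 2 by lra.
  have -> : y 0 0 ^+ 2 = 1 + y 0 1 ^+ 2 + y 0 2 ^+ 2 by lra.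
  move=> e; lra.
have := sqr_ge0 (x 0 1 - y 0 1); have := sqr_ge0 (x 0 2 - y 0 2).
have := sqr_ge0 (x 0 1 * y 0 2 - x 0 2 * y 0 1) => h1 h2 h3 h4.
have e1 : x 0 1 = y 0 1.
  by apply/eqP; rewrite -subr_eq0 -sqrf_eq0; apply/eqP; lra.
have e2 : x 0 2 = y 0 2.
  by apply/eqP; rewrite -subr_eq0 -sqrf_eq0; apply/eqP; lra.
apply: rV3P => //; apply/eqP.
rewrite -(@eqrXn2 _ 2)//; [|exact: ltW..].
by move: hx hy; rewrite e1 e2 => hx hy; apply/eqP; lra.
Qed.

Lemma lorentz_lt X Y : X <> Y -> lorentz X Y < -1.
Proof.
by move=> XY; rewrite lt_neqAle lorentz_le andbT; apply/eqP => /lorentz_eq.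
Qed.

Lemma lorentz_lt0 X Y : lorentz X Y < 0.
Proof. by have := lorentz_le X Y; lra. Qed.

Lemma hpoint_scale X Y k : hvec Y = k *: hvec X -> Y = X.
Proof.
move=> YX; have k0 : 0 < k.
  by have := hpoint_gt0 Y; rewrite YX mxE pmulr_lgt0// hpoint_gt0.
apply: hvec_inj; rewrite YX; have := hpoint_norm Y.
rewrite YX !lorentzE hpoint_norm => h.
have : k ^+ 2 = 1 ^+ 2 by lra.
by move/eqP; rewrite eqrXn2// ?ltW// => /eqP ->; rewrite scale1r.
Qed.

(** If [v 0 0 <= 0], the spatial product lies below the nonpositive time product; squaring
    contradicts Cauchy-Schwarz for the spatial parts. *)
Lemma timelike_future v P : lorentz v v < 0 -> lorentz v P < 0 -> 0 < v 0 0.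
Proof.
move: (hpoint_norm P) (hpoint_gt0 P); rewrite /lorentz.
move: (hvec P) => p hp p0 vv vp; rewrite ltNge; apply/negP => v0.
have vp0 : 0 <= - v 0 0 * p 0 0 by rewrite mulr_ge0//; lra.
have : (v 0 0 * p 0 0) ^+ 2 <= (v 0 1 * p 0 1 + v 0 2 * p 0 2) ^+ 2.
  rewrite -[X in X <= _]sqrrN -[X in _ <= X]sqrrN ler_pXn2r// ?nnegrE; lra.
have -> : (v 0 1 * p 0 1 + v 0 2 * p 0 2) ^+ 2 =
  (v 0 1 ^+ 2 + v 0 2 ^+ 2) * (p 0 1 ^+ 2 + p 0 2 ^+ 2)
  - (v 0 1 * p 0 2 - v 0 2 * p 0 1) ^+ 2 by ring.
have -> : p 0 1 ^+ 2 + p 0 2 ^+ 2 = p 0 0 ^+ 2 - 1 by lra.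
have := sqr_ge0 (v 0 1 * p 0 2 - v 0 2 * p 0 1).
have := sqr_ge0 (v 0 1); have := sqr_ge0 (v 0 2).
set s := v 0 1 ^+ 2 + v 0 2 ^+ 2 => s2 s1 q h.
have sv : s < v 0 0 ^+ 2 by rewrite /s; lra.
have : (v 0 0 ^+ 2 - s) * p 0 0 ^+ 2 > 0 by rewrite mulr_gt0 ?exprn_gt0 ?subr_gt0.
move: h; rewrite exprMn /s; nra.
Qed.

Lemma normalize v : lorentz v v < 0 -> 0 < v 0 0 ->
  exists X : hpoint R, hvec X = (Num.sqrt (- lorentz v v))^-1 *: v.
Proof.
move=> vv v0; set k := Num.sqrt _.
have k0 : 0 < k by rewrite sqrtr_gt0 oppr_gt0.
have k2 : k ^+ 2 = - lorentz v v by rewrite sqr_sqrtr// oppr_ge0 ltW.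
suff h : (lorentz (k^-1 *: v) (k^-1 *: v) == -1) && (0 < (k^-1 *: v) 0 0).
  by exists (HPoint h).
rewrite !lorentzE mxE mulr_gt0 ?invr_gt0// andbT.
rewrite -[lorentz v v]opprK -k2; apply/eqP; field; exact: lt0r_neq0.
Qed.

Lemma normalize_unsigned v : lorentz v v < 0 ->
  exists (X : hpoint R) k, hvec X = k *: v.
Proof.
move=> vv; have [v0|v0|v0] := ltrgt0P (v 0 0).
- by have [X XE] := normalize vv v0; exists X; eexists; exact: XE.
- have [||X XE] := @normalize (-1 *: v).
  + by rewrite !lorentzE; lra.
  + by rewrite mxE; lra.
  by exists X; eexists; rewrite XE scalerA.
- move: vv; rewrite /lorentz v0; have := sqr_ge0 (v 0 1).
  by have := sqr_ge0 (v 0 2); lra.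
Qed.

(** The factor of [P] puts the sum on the hyperboloid. This supplies a second point on a line known
    by a point and a tangent vector. *)
Lemma move_along P m : lorentz P m = 0 -> 0 < lorentz m m ->
  exists X : hpoint R, X <> P /\ hvec X = m + Num.sqrt (1 + lorentz m m) *: hvec P.
Proof.
move=> Pm mm; set k := Num.sqrt _.
have k0 : 0 < k by rewrite sqrtr_gt0; lra.
have k2 : k ^+ 2 = 1 + lorentz m m by rewrite sqr_sqrtr//; lra.
have vv : lorentz (m + k *: hvec P) (m + k *: hvec P) = -1.
  by rewrite !lorentzE hpoint_norm (lorentzC m) Pm; lra.
have h : (lorentz (m + k *: hvec P) (m + k *: hvec P) == -1) &&
    (0 < (m + k *: hvec P) 0 0).
  rewrite vv eqxx /=; apply: (@timelike_future _ P); rewrite ?vv; first lra.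
  by rewrite !lorentzE hpoint_norm (lorentzC m) Pm; lra.
exists (HPoint h); split => // /(congr1 (fun X => lorentz (hvec X) m)).
by rewrite /= !lorentzE Pm mulr0 addr0 => mm0; rewrite mm0 ltxx in mm.
Qed.

Lemma lcross_spacelike X Y : X <> Y -> 0 < lorentz (lcross X Y) (lcross X Y).
Proof.
move=> /lorentz_lt XY; rewrite lorentz_lcross !hpoint_norm (lorentzC Y).
by have : 0 < (-1 - lorentz X Y) * (1 - lorentz X Y); [apply: mulr_gt0; lra|lra].
Qed.

Lemma normal_colinear X Y n : X <> Y -> lorentz X n = 0 -> lorentz Y n = 0 ->
  exists c, n = c *: lcross X Y.
Proof.
move=> /lcross_spacelike XY Xn Yn.
eexists; apply: lcross0_colinear; [exact: lt0r_neq0|exact: lcross_orth].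
Qed.

(** Perpendicular lines share at most one point: two would make [n] and [m] multiples of the same
    spacelike vector. *)
Lemma hpoint_orth2 X Y n m : 0 < lorentz n n -> 0 < lorentz m m ->
  lorentz n m = 0 -> lorentz X n = 0 -> lorentz X m = 0 ->
  lorentz Y n = 0 -> lorentz Y m = 0 -> X = Y.
Proof.
move=> nn mm nm Xn Xm Yn Ym; apply: contrapT => XY.
have z := lcross_spacelike XY.
have [c nE] := normal_colinear XY Xn Yn; have [d mE] := normal_colinear XY Xm Ym.
move: nn mm nm; rewrite nE mE !lorentzE; move: (lorentz _ _) z => z z0.
move=> c0 d0 /eqP; rewrite !mulf_eq0 (gt_eqF z0) orbF => /orP[] /eqP e.
- by rewrite e mul0r ltxx in c0.
- by rewrite e mul0r ltxx in d0.
Qed.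

(** * Lines described by spacelike normal vectors *)

Definition normal_line n : set (hpoint R) := [set Z | lorentz n Z = 0].

Lemma normal_lineZ c n : c != 0 -> normal_line (c *: n) = normal_line n.
Proof.
move=> c0; apply/seteqP; split => Z; rewrite /normal_line /= lorentzZl.
- by move/eqP; rewrite mulf_eq0 (negPf c0) => /eqP.
- by move->; rewrite mulr0.
Qed.

Lemma hlineE X Y : X <> Y -> hline X Y = normal_line (lcross X Y).
Proof.
move=> XY; have n0 := lcross_spacelike XY; apply/seteqP; split => Z.
- move=> [s [t ZE]]; rewrite /normal_line /= ZE !lorentzE.
  by rewrite lcross_l lcross_r; ring.
(* The normal component of [Z] drops out of [lcross_expand], which then gives both coefficients. *)
- rewrite /normal_line /= => h; have := lcross_expand X Y Z.
  rewrite h scale0r add0r; set a := (V in V *: hvec X); set b := (V in V *: hvec Y).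
  move=> e; exists ((lorentz (lcross X Y) (lcross X Y))^-1 * a).
  exists ((lorentz (lcross X Y) (lcross X Y))^-1 * b).
  by rewrite -!scalerA -scalerDr -e scalerA mulVf ?scale1r// lt0r_neq0.
Qed.

Lemma hline_normal X Y n : X <> Y -> 0 < lorentz n n ->
  lorentz X n = 0 -> lorentz Y n = 0 -> hline X Y = normal_line n.
Proof.
move=> XY nn Xn Yn; have [c nE] := normal_colinear XY Xn Yn.
rewrite hlineE// nE normal_lineZ//; apply: contraTneq nn => c0.
by rewrite nE c0 !lorentzE mul0r ltxx.
Qed.

Lemma is_hline_normal L : is_hline L -> exists n, 0 < lorentz n n /\ L = normal_line n.
Proof.
move=> [X [Y [XY ->]]]; exists (lcross X Y).
by split; [exact: lcross_spacelike|exact: hlineE].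
Qed.

(** * Right angles, distances, perpendicularity and midpoints *)

Lemma hdir_norm_gt0 P X : X <> P -> 0 < tnorm (hdir P X).
Proof.
move=> /lorentz_lt XP; rewrite /tnorm sqrtr_gt0 /hdir !lorentzE !hpoint_norm.
rewrite (lorentzC P).
by have : 0 < (-1 - lorentz X P) * (1 - lorentz X P); [apply: mulr_gt0; lra|lra].
Qed.

Lemma lorentz_hdir P X Y :
  lorentz (hdir P X) (hdir P Y) = lorentz X Y + lorentz P X * lorentz P Y.
Proof. by rewrite /hdir !lorentzE hpoint_norm (lorentzC X P); ring. Qed.

Lemma acos_eq_pihalf (x : R) : (acos x = pi / 2) <-> (x = 0).
Proof.
split => [|->]; last exact: acos0.
rewrite acos.unlock; case: xgetP => [y _ [_ yx] yp|_ /esym].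
  by rewrite -yx yp cos_pihalf.
(* [acos] takes the junk value [0] outside [[-1, 1]]. *)
rewrite /point /= => /eqP.
by rewrite mulf_eq0 invr_eq0 (gt_eqF (pi_gt0 R)) pnatr_eq0.
Qed.

Lemma hangle_right P X Y : X <> P -> Y <> P ->
  hangle X P Y = pi / 2 <-> lorentz X Y + lorentz P X * lorentz P Y = 0.
Proof.
move=> XP YP; rewrite /hangle acos_eq_pihalf lorentz_hdir.
split => [/eqP|->]; last by rewrite mul0r.
by rewrite mulf_eq0 invr_eq0 mulf_eq0 !(gt_eqF (hdir_norm_gt0 _))// !orbF => /eqP.
Qed.

Lemma hangleC P X Y : hangle X P Y = hangle Y P X.
Proof. by rewrite /hangle lorentzC [tnorm _ * _]mulrC. Qed.

(** The argument of [ln] is positive and strictly increasing on [x >= 1]. *)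
Lemma arcosh_inj (x y : R) : 1 <= x -> 1 <= y -> arcosh x = arcosh y -> x = y.
Proof.
wlog xy : x y / x < y => [wl x1 y1 h|x1 y1].
  by have [/wl|/wl/(_ y1 x1 (esym h))|] := ltrgtP x y; [exact|move->|].
have x0 : 0 < x + Num.sqrt (x ^+ 2 - 1) by have := sqrtr_ge0 (x ^+ 2 - 1); lra.
have y0 : 0 < y + Num.sqrt (y ^+ 2 - 1) by have := sqrtr_ge0 (y ^+ 2 - 1); lra.
move=> /ln_inj; rewrite !posrE => /(_ x0 y0).
have : Num.sqrt (x ^+ 2 - 1) <= Num.sqrt (y ^+ 2 - 1).
  by apply: ler_wsqrtr; rewrite lerD2r ler_pXn2r ?nnegrE //; lra.
lra.
Qed.

(** At a common point [P] the normals are multiples of [lcross P X] and [lcross P Y], whose Lorentz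
    product is the expression in [hangle_right]. *)
Lemma perpendicular_normal n m : 0 < lorentz n n -> 0 < lorentz m m ->
  perpendicular (normal_line n) (normal_line m) <-> lorentz n m = 0.
Proof.
move=> nn mm; split.
  move=> [_ _ [P [X [Y [[nP mP] [nX XP] [mY YP]]]]]].
  move=> /(hangle_right XP YP).
  rewrite /normal_line /= in nP mP nX mY.
  have [||c ->] := @normal_colinear P X n (nesym XP); rewrite 1?lorentzC//.
  have [||d ->] := @normal_colinear P Y m (nesym YP); rewrite 1?lorentzC//.
  rewrite !lorentzE lorentz_lcross hpoint_norm (lorentzC X P) => e.
  have -> : lorentz P Y * lorentz P X - -1 * lorentz X Y = 0 by lra.
  by rewrite !mulr0.
move=> nm.
(* Orthogonality makes [lcross n m] timelike, so the lines meet; each normal is then a direction of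
   the other line. *)
have [|P [k PE]] := @normalize_unsigned (lcross n m).
  rewrite lorentz_lcross nm (lorentzC m) nm mul0r sub0r oppr_lt0.
  exact: mulr_gt0.
have Pn : lorentz P n = 0 by rewrite PE lorentzZl lcross_l mulr0.
have Pm : lorentz P m = 0 by rewrite PE lorentzZl lcross_r mulr0.
have [X [XP XE]] := move_along Pm mm.
have [Y [YP YE]] := move_along Pn nn.
have Xn : lorentz X n = 0 by rewrite XE !lorentzE Pn lorentzC nm mulr0 addr0.
have Ym : lorentz Y m = 0 by rewrite YE !lorentzE Pm nm mulr0 addr0.
split.
- by exists X, P; split => //; rewrite (hline_normal XP nn Xn Pn).
- by exists Y, P; split => //; rewrite (hline_normal YP mm Ym Pm).
exists P, X, Y; split; rewrite /normal_line /= ?(lorentzC n) ?(lorentzC m)//.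
apply/(hangle_right XP YP).
rewrite XE YE !lorentzE hpoint_norm Pm Pn (lorentzC _ P) Pm (lorentzC m n) nm; ring.
Qed.

(** Equal distances from a point [s X + t Y] force [(s - t) (1 + <X, Y>) = 0]; the second factor
    vanishes only in the degenerate case [X = Y]. *)
Lemma midpoint_unique X Y M k : hvec M = k *: (hvec X + hvec Y) ->
  unique (is_midpoint X Y) M.
Proof.
move=> ME; have g := lorentz_le X Y.
have k0 : 0 < k.
  have := lorentz_lt0 M X; rewrite ME !lorentzE hpoint_norm (lorentzC Y).
  by rewrite nmulr_llt0//; lra.
split.
  split; last by rewrite /hdist ME !lorentzE !hpoint_norm; congr arcosh; ring.
  by exists k, k; rewrite ME scalerDr; split => //; exact: ltW.
move=> Z [[s [t [s0 t0 ZE]]]] /arcosh_inj.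
have XZ := lorentz_le X Z; have ZY := lorentz_le Z Y.
move=> /(_ ltac:(lra) ltac:(lra)); rewrite ZE !lorentzE !hpoint_norm => e.
have {e} : (s - t) * (1 + lorentz X Y) = 0 by lra.
move=> /eqP; rewrite mulf_eq0 subr_eq0 => /orP[/eqP st|g1].
  apply: (@hpoint_scale _ _ (k * s^-1)); rewrite ME ZE -st -scalerDr scalerA.
  rewrite -mulrA mulVf ?mulr1//; apply/eqP => s_0.
  by have := hpoint_gt0 Z; rewrite ZE -st s_0 !scale0r addr0 mxE ltxx.
have XY : X = Y by apply: lorentz_eq; move/eqP: g1; lra.
have -> : Z = X by apply: (@hpoint_scale _ _ (s + t)); rewrite ZE -XY scalerDl.
by apply: (@hpoint_scale _ _ (k + k)); rewrite ME -XY scalerDr scalerDl.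
Qed.

Lemma midpoint_exists X Y : exists (M : hpoint R) k, hvec M = k *: (hvec X + hvec Y).
Proof.
apply: normalize_unsigned; rewrite !lorentzE !hpoint_norm (lorentzC Y).
by have := lorentz_le X Y; lra.
Qed.

End Points.

(** * Consequences of a right angle at a vertex *)

Section Pentagon.
Variable R : realType.
Implicit Types (A B D P Q X : hpoint R) (n : 'rV[R]_3).

(** The right angle makes [hdir P X] orthogonal to [Q] as well as to [P], hence normal to the line
    [PQ]. *)
Lemma right_angle_decomp P Q X : X <> P -> Q <> P ->
  hangle X P Q = pi / 2 ->
  exists b, b != 0 /\ hvec X = (- lorentz P X) *: hvec P + b *: lcross P Q.
Proof.
move=> XP QP /(hangle_right XP QP) h.
have [||b bE] := @normal_colinear R P Q (hdir P X) (nesym QP).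
- by rewrite /hdir !lorentzE hpoint_norm; ring.
- by rewrite /hdir !lorentzE lorentzC (lorentzC Q P).
have XE : hvec X = (- lorentz P X) *: hvec P + b *: lcross P Q.
  by rewrite -bE /hdir scaleNr addrC addrK.
exists b; split => //; apply/eqP => b0; apply: XP; apply: hpoint_scale.
by rewrite XE b0 scale0r addr0; reflexivity.
Qed.

(** The decomposition of [B] enters the right-angle equation at [B]; then [<B, B> = -1] eliminates
    [1 - <P, B>^2] and a factor [b] cancels. *)
Lemma right_angle_relation A B P n b : 0 < lorentz n n -> lorentz P n = 0 ->
  b != 0 -> A <> B -> P <> B -> hvec B = (- lorentz P B) *: hvec P + b *: n ->
  hangle A B P = pi / 2 -> b * lorentz P A * lorentz n n = lorentz P B * lorentz n A.
Proof.
move=> nn Pn b0 AB PB BE /(hangle_right AB PB).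
have := hpoint_norm B; have : lorentz B A = - lorentz P B * lorentz P A + b * lorentz n A.
  by rewrite {1}BE !lorentzE.
have -> : lorentz B B = - lorentz P B ^+ 2 + b ^+ 2 * lorentz n n.
  by rewrite {1 2}BE !lorentzE hpoint_norm Pn (lorentzC n) Pn; ring.
rewrite (lorentzC A) (lorentzC B P) => -> /(congr1 ( *%R (lorentz P A))) e h.
apply: (mulfI b0); lra.
Qed.

End Pentagon.

(** * The midpoints in a 4-right pentagon *)

Theorem theorem8 (R : realType) (A B1 B2 D2 D1 : hpoint R)
    (hP : four_right_pentagon A B1 B2 D2 D1) :
  exists (As : hpoint R) (N : set (hpoint R)) (Cs M : hpoint R),
    [/\ unique (is_orth_projection (hline B2 D2) A) As,
        unique (common_perpendicular (hline B1 D1) (hline B2 D2)) N,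
        unique (N `&` hline B2 D2) Cs,
        unique (is_midpoint B2 D2) M
      & unique (is_midpoint As Cs) M].
Proof.
have [[inj _] [hB1 hB2 hD2 hD1]] := hP.
have neq i j : i != j -> tnth [tuple A; B1; B2; D2; D1] i <>
    tnth [tuple A; B1; B2; D2; D1] j by move=> /eqP ij /inj.
have AB : A <> B1 := neq 0 1 isT.
have B12 : B1 <> B2 := neq 1 2 isT.
have BD2 : B2 <> D2 := neq 2 3 isT.
have D12 : D1 <> D2 := neq 4 3 isT.
have AD : A <> D1 := neq 0 4 isT.
have BD1 : B1 <> D1 := neq 1 4 isT.
set n := lcross B2 D2.
have nn : 0 < lorentz n n := lcross_spacelike BD2.
have pn : lorentz B2 n = 0 by rewrite lorentzC lcross_l.
have qn : lorentz D2 n = 0 by rewrite lorentzC lcross_r.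
have [b [b0 bE]] := right_angle_decomp B12 (nesym BD2) hB2.
(* At [D2] the decomposition uses [lcross D2 B2], which is [- n]; hence the change of sign of
   [d]. *)
have [d [d0 dE]] : exists d, d != 0 /\
    hvec D1 = (- lorentz D2 D1) *: hvec D2 + d *: n.
  have [|d [d0 dE]] := right_angle_decomp D12 BD2 _.
    by rewrite hangleC.
  exists (- d); rewrite oppr_eq0; split => //; rewrite {1}dE; congr (_ + _).
  by apply: rV3P; rewrite /n !mxE /=; ring.
have e1 := right_angle_relation nn pn b0 AB (nesym B12) bE hB1.
have e2 : d * lorentz D2 A * lorentz n n = lorentz D2 D1 * lorentz n A.
  apply: right_angle_relation nn qn d0 AD (nesym D12) dE _.
  by rewrite hangleC.
(* Coordinates of [A] in the frame [B2], [D2], [n], read off [lcross_expand]. *)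
pose g := lorentz B2 D2; pose a := lorentz n A / lorentz n n.
pose al := (g * lorentz A D2 + lorentz A B2) / lorentz n n.
pose be := (g * lorentz A B2 + lorentz A D2) / lorentz n n.
have AE : hvec A = al *: hvec B2 + be *: hvec D2 + a *: n.
  have := lcross_expand B2 D2 A; rewrite -/n !hpoint_norm !mulN1r !opprK => e.
  apply: (scalerI (lt0r_neq0 nn)); rewrite e !scalerDr !scalerA /al /be /a.
  by rewrite !(mulrC (lorentz n n)) !mulfVK ?lt0r_neq0// -addrA addrC.
set v := al *: hvec B2 + be *: hvec D2 in AE.
(* The mirror image of [v] in the perpendicular bisector of [B2 D2]. *)
pose v' := be *: hvec B2 + al *: hvec D2.
have vn : lorentz v n = 0 by rewrite /v !lorentzE pn qn; ring.
have v'n : lorentz v' n = 0 by rewrite /v' !lorentzE pn qn; ring.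
have vB : lorentz v B2 = lorentz A B2 by rewrite AE !lorentzE (lorentzC n) pn; ring.
have vD : lorentz v D2 = lorentz A D2 by rewrite AE !lorentzE (lorentzC n) qn; ring.
have v'B : lorentz v' B2 = lorentz A D2.
  by rewrite -vD /v /v' !lorentzE !hpoint_norm (lorentzC D2); ring.
have v'D : lorentz v' D2 = lorentz A B2.
  by rewrite -vB /v /v' !lorentzE !hpoint_norm (lorentzC D2); ring.
have vv : lorentz v v < 0.
  move: v AE vn {vB vD} => z AE zn.
  have := hpoint_norm A; rewrite AE !lorentzE zn (lorentzC n z) zn => e.
  by have := mulr_ge0 (sqr_ge0 a) (ltW nn); lra.
have v'v' : lorentz v' v' = lorentz v v.
  by rewrite /v /v' !lorentzE !hpoint_norm (lorentzC D2); ring.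
have [|As AsE] := normalize vv _.
  by apply: (@timelike_future _ _ B2) => //; rewrite vB lorentz_lt0.
have [||Cs CsE] := @normalize _ v'.
- by rewrite v'v'.
- by apply: (@timelike_future _ _ B2); rewrite ?v'v'// v'B lorentz_lt0.
(* Equal norms give [As] and [Cs] the same normalizing factor [k]. *)
rewrite v'v' in CsE; move: (_^-1) AsE CsE => k AsE CsE.
have Asn : lorentz As n = 0 by rewrite AsE lorentzZl vn mulr0.
have Csn : lorentz Cs n = 0 by rewrite CsE lorentzZl v'n mulr0.
have [M [t ME]] := midpoint_exists B2 D2.
have MAC : exists r, hvec M = r *: (hvec As + hvec Cs).
  have ACE : hvec As + hvec Cs = (k * (al + be)) *: (hvec B2 + hvec D2).
    by rewrite AsE CsE; apply: rV3P; rewrite !mxE; ring.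
  exists (t / (k * (al + be))); rewrite ACE scalerA mulfVK//.
  (* A zero factor would give [As + Cs = 0], but both have a negative product with [B2]. *)
  apply: contra_eq_neq ACE => ->; apply/eqP => AC0.
  have := lorentz_lt0 As B2; have := lorentz_lt0 Cs B2.
  have := lorentzDl As Cs B2; rewrite AC0 lorentzZl; lra.
pose u := lcross B1 D1; have uu : 0 < lorentz u u := lcross_spacelike BD1.
(* Normal of the line through [Cs] perpendicular to [B2 D2]. *)
pose w := lcross Cs n.
have ww : 0 < lorentz w w.
  by rewrite lorentz_lcross Csn (lorentzC n) Csn hpoint_norm; lra.
have wn : lorentz w n = 0 by exact: lcross_r.
have nB1 : lorentz n B1 = b * lorentz n n.
  by rewrite bE -/n !lorentzE (lorentzC n B2) pn; ring.
have nD1 : lorentz n D1 = d * lorentz n n.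
  by rewrite dE !lorentzE (lorentzC n D2) qn; ring.
have wu : lorentz w u = 0.
  have CB1 : lorentz Cs B1 = - lorentz B2 B1 * (k * lorentz D2 A).
    by rewrite {1}bE -/n !lorentzE Csn CsE lorentzZl v'B (lorentzC A); ring.
  have CD1 : lorentz Cs D1 = - lorentz D2 D1 * (k * lorentz B2 A).
    by rewrite {1}dE !lorentzE Csn CsE lorentzZl v'D (lorentzC A); ring.
  (* Binet-Cauchy leaves two terms, which [e1] and [e2] make equal. *)
  rewrite lorentz_lcross CB1 CD1 nB1 nD1.
  transitivity (k * (lorentz B2 B1 * (d * lorentz D2 A * lorentz n n)
                   - lorentz D2 D1 * (b * lorentz B2 A * lorentz n n))); first by ring.
  by rewrite e1 e2; ring.
(* The lines [B1 D1] and [B2 D2] differ, since [B1] is off the latter; uniqueness of the common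
   perpendicular rests on this. *)
have un0 : lcross u n != 0.
  apply/eqP => /(lcross0_colinear (lt0r_neq0 uu)) nE.
  have /eqP : lorentz n B1 = 0 by rewrite nE lorentzZl lcross_l mulr0.
  by rewrite nB1 mulf_eq0 (negPf b0) (gt_eqF nn).
exists As, (normal_line w), Cs, M.
rewrite (hlineE BD2) (hlineE BD1) -/n -/u; split.
- split.
    split; first by rewrite /normal_line /= lorentzC.
    exists (normal_line (lcross A n)); split.
    + apply/perpendicular_normal => //; last exact: lcross_r.
      rewrite lorentz_lcross hpoint_norm (lorentzC n A).
      by have := sqr_ge0 (lorentz A n); lra.
    + exact: lcross_l.
    + rewrite /normal_line /= AsE lorentzZr.
      have -> : v = hvec A + (- a) *: n by rewrite {1}AE scaleNr addrK.
      by rewrite !lorentzE lcross_l lcross_r; ring.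
  move=> F [nF [L [pL]]]; have [/is_hline_normal[m [mm LE]] _ _] := pL.
  move: pL; rewrite {}LE /normal_line /= => /(perpendicular_normal mm nn) mn mA mF.
  (* Any perpendicular through [A] contains [As], a combination of [A] and [n]. *)
  apply: (hpoint_orth2 mm nn) => //; rewrite lorentzC//.
  rewrite AsE lorentzZr; have -> : v = hvec A + (- a) *: n by rewrite {1}AE scaleNr addrK.
  by rewrite !lorentzE mA mn; ring.
- split; first by split; apply/perpendicular_normal.
  (* A vector orthogonal to both [u] and [n] is parallel to [lcross u n]. *)
  have unique_normal m : 0 < lorentz m m -> lorentz m u = 0 -> lorentz m n = 0 ->
      normal_line m = normal_line (lcross u n).
    move=> mm mu mn; have h : lcross m (lcross u n) = 0.
      by rewrite lcrossC lcross_orth ?oppr0// lorentzC.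
    have hE := lcross0_colinear (lt0r_neq0 mm) h.
    rewrite hE normal_lineZ//; apply: contra_neq un0 => c0.
    by rewrite hE c0 scale0r.
  move=> L [pu pn']; have [/is_hline_normal[m [mm LE]] _ _] := pu.
  move: pu pn'; rewrite {}LE.
  move=> /(perpendicular_normal mm uu) mu /(perpendicular_normal mm nn) mn.
  by rewrite !unique_normal.
- split; first by split; [exact: lcross_l | rewrite /normal_line /= lorentzC].
  move=> X [wX nX]; apply: (hpoint_orth2 ww nn) => //; rewrite lorentzC//.
  exact: lcross_l.
- exact: midpoint_unique ME.
- have [r rE] := MAC; exact: midpoint_unique rE.
Qed.
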